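(* Let $M_1\subseteq \mathbb{Z}_3^2\times\mathbb{Z}_8\times\mathbb{Z}_2$ be the explicit set given in the context. Then $M_1$ is a Hadamard difference set with parameters $(144,66,30)$, of order $36$, and the character $\psi_{(0,1)}\chi_{(1,0)}$ has the Gauss value $$\psi_{(0,1)}\chi_{(1,0)}(M_1)=2(\zeta_3-\zeta_3^2)\,\overline{X}\,\zeta_{24}^{22}.$$
   Context: Write $\zeta_m=e^{2\pi i/m}$, $X=1+\zeta_8+\zeta_8^3$, and $\overline{X}$ for its complex conjugate. For a positive integer $n$ divisible by $3$, a Gauss value of modulus $n$ is a complex number of the form $\frac n3(\zeta_3-\zeta_3^2)Y\zeta$ with $Y\in\{X,\overline X\}$ and $\zeta$ a root of unity. For a subset $B$ of a finite abelian group $G$ and a complex character $\chi$ of $G$, $\chi(B)=\sum_{g\in B}\chi(g)$. A Hadamard difference set (HDS) of order $n^2$ in $G$ with $|G|=4n^2$ is a $(4n^2,2n^2-n,n^2-n)$ difference set in $G$: a subset $D$ with $|D|=2n^2-n$ such that every nonzero element of $G$ has exactly $n^2-n$ representations as a difference of two elements of $D$ (equivalently, $|D|=2n^2-n$ and $|\chi(D)|=n$ for all nontrivial characters $\chi$ of $G$). Let $W=\mathbb{Z}_3^2$. Elements of $W\times\mathbb{Z}_8\times\mathbb{Z}_2$ are written $(u,v,x,y)$ with $(u,v)\in W$, $x\in\mathbb{Z}_8$, $y\in\mathbb{Z}_2$. The characters are $\psi_{(p,q)}\chi_{(s,t)}$ with $\psi_{(p,q)}(u,v)=\zeta_3^{pu+qv}$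 and $\chi_{(s,t)}(x,y)=\zeta_8^{sx}(-1)^{ty}$. Set $M_1=\bigcup_{(u,v)\in W}\{(u,v)\}\times M_{(u,v)}$, where $M_{(u,v)}\subseteq\mathbb{Z}_8\times\mathbb{Z}_2$ is given by its $8\times 2$ indicator matrix, listed below as the rows $x=0,1,\dots,7$ in order; each row is a two-digit string whose digits are the entries for $y=0,1$ (so $(x,y)\in M_{(u,v)}$ iff the corresponding digit is $1$): $M_{(0,0)}$: 11, 11, 11, 00, 00, 00, 00, 11 $M_{(0,1)}$: 11, 00, 00, 11, 00, 11, 11, 00 $M_{(0,2)}$: 11, 10, 10, 11, 00, 01, 10, 11 $M_{(1,0)}$: 10, 10, 10, 10, 01, 01, 01, 01 $M_{(1,1)}$: 10, 11, 01, 00, 10, 11, 01, 00 $M_{(1,2)}$: 01, 00, 01, 00, 01, 00, 01, 00 $M_{(2,0)}$: 10, 11, 01, 00, 10, 11, 01, 00 $M_{(2,1)}$: 01, 10, 01, 01, 10, 01, 10, 10 $M_{(2,2)}$: 01, 00, 01, 00, 01, 00, 01, 00 *)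

(* Defs.v *)
From HB Require Import structures.
From mathcomp Require Import all_boot all_order all_algebra.
From mathcomp Require Import reals trigo.
From mathcomp Require Import complex.

Set Implicit Arguments.
Unset Strict Implicit.
Unset Printing Implicit Defensive.

Import Order.TTheory GRing.Theory Num.Theory.
Local Open Scope ring_scope.
Local Open Scope complex_scope.

Definition difference_set (G : finZmodType) (v k lambda : nat) (D : {set G}) :
    Prop :=
  [/\ #|G| = v, #|D| = k &
      forall g : G, g != 0 ->
        #|[set ab in setX D D | ab.1 - ab.2 == g]| = lambda].

(* A Hadamard difference set of order n ^ 2; the argument is n, not n ^ 2. *)
Definition hadamard_difference_set (G : finZmodType) (n : nat) (D : {set G}) :
    Prop :=
  (0 < n)%N /\
  difference_set (4 * n ^ 2)%N (2 * n ^ 2 - n)%N (n ^ 2 - n)%N D.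

Definition is_character (R : realType) (G : finZmodType) (chi : G -> R[i]) :
    Prop :=
  chi 0 = 1 /\ forall g h : G, chi (g + h) = chi g * chi h.

Definition char_sum (R : realType) (G : finZmodType) (chi : G -> R[i])
    (B : {set G}) : R[i] :=
  \sum_(g in B) chi g.

(* zeta R m = e^{2 pi i / m}, by Euler's formula. *)
Definition zeta (R : realType) (m : nat) : R[i] :=
  cos (2 * pi / m%:R) +i* sin (2 * pi / m%:R).

Definition gaussX (R : realType) : R[i] := 1 + zeta R 8 + zeta R 8 ^+ 3.

(* 0.-unity_root holds of every element, whence the condition 0 < m. *)
Definition gauss_value (R : realType) (n : nat) (w : R[i]) : Prop :=
  [/\ (0 < n)%N, (3 %| n)%N &
      exists Y z : R[i],
        [/\ Y = gaussX R \/ Y = ((gaussX R)^*)%R,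
            exists2 m : nat, (0 < m)%N & m.-unity_root z &
            w = n%:R / 3%:R * (zeta R 3 - zeta R 3 ^+ 2) * Y * z]].

(* A named product, since pairs carry no finZmodType instance by default. *)
Definition grp := ('Z_3 * 'Z_3 * 'Z_8 * 'Z_2)%type.
HB.instance Definition _ := GRing.Zmodule.on grp.
HB.instance Definition _ := Finite.on grp.

(* Exponents are computed in nat from the representatives in 'Z_m; this is
   well defined because the bases are roots of unity of the right order. *)
Definition psi (R : realType) (p q u v : 'Z_3) : R[i] :=
  zeta R 3 ^+ (p * u + q * v)%N.

Definition chi (R : realType) (s : 'Z_8) (t : 'Z_2) (x : 'Z_8) (y : 'Z_2) :
    R[i] :=
  zeta R 8 ^+ (s * x)%N * (-1) ^+ (t * y)%N.

Definition psichi (R : realType) (p q : 'Z_3) (s : 'Z_8) (t : 'Z_2)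
    (g : grp) : R[i] :=
  let: (u, v, x, y) := g in psi R p q u v * chi R s t x y.

(* r_ab is the row with entries a at y = 0 and b at y = 1. *)
Definition r00 := [:: false; false].
Definition r01 := [:: false; true].
Definition r10 := [:: true; false].
Definition r11 := [:: true; true].

Definition M_rows (u v : nat) : seq (seq bool) :=
  match u, v with
  | 0, 0 => [:: r11; r11; r11; r00; r00; r00; r00; r11]
  | 0, 1 => [:: r11; r00; r00; r11; r00; r11; r11; r00]
  | 0, 2 => [:: r11; r10; r10; r11; r00; r01; r10; r11]
  | 1, 0 => [:: r10; r10; r10; r10; r01; r01; r01; r01]
  | 1, 1 => [:: r10; r11; r01; r00; r10; r11; r01; r00]
  | 1, 2 => [:: r01; r00; r01; r00; r01; r00; r01; r00]
  | 2, 0 => [:: r10; r11; r01; r00; r10; r11; r01; r00]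
  | 2, 1 => [:: r01; r10; r01; r01; r10; r01; r10; r10]
  | 2, 2 => [:: r01; r00; r01; r00; r01; r00; r01; r00]
  | _, _ => [::]
  end%N.

Definition M_block (u v : 'Z_3) : {set 'Z_8 * 'Z_2} :=
  [set xy : 'Z_8 * 'Z_2 | nth false (nth [::] (M_rows u v) xy.1) xy.2].

Definition M1 : {set grp} :=
  [set g : grp | let: (u, v, x, y) := g in (x, y) \in M_block u v].

Lemma zeta_expE (R : realType) (m k : nat) :
  zeta R m ^+ k =
  cos (2 * pi / m%:R *+ k) +i* sin (2 * pi / m%:R *+ k).
Proof.
elim: k => [|k IHk]; first by rewrite expr0 !mulr0n cos0 sin0.
rewrite exprS IHk /zeta; move: (2 * pi / m%:R) => a.
by rewrite mulrS cosD sinD [sin _ * cos _ + _]addrC.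
Qed.

Lemma zeta_exp_order (R : realType) (m : nat) : (0 < m)%N ->
  zeta R m ^+ m = 1.
Proof.
move=> m_gt0; rewrite zeta_expE -[_ *+ m]mulr_natr mulfVK ?pnatr_eq0 -?lt0n //.
by rewrite mulr_natl cos2pi sin2pi.
Qed.

Lemma psichi_is_character (R : realType) (p q : 'Z_3) (s : 'Z_8) (t : 'Z_2) :
  is_character (psichi R p q s t).
Proof.
have z3 := @zeta_exp_order R 3 isT.
have z8 := @zeta_exp_order R 8 isT.
have z2 : (-1 : R[i]) ^+ 2 = 1 by rewrite sqrrN expr1n.
have red (z : R[i]) d a b c : z ^+ d = 1 ->
    z ^+ (a * ((b + c) %% d))%N = z ^+ (a * b)%N * z ^+ (a * c)%N.
  move=> zd; rewrite -exprD -mulnDr -[RHS](expr_mod _ zd) -[LHS](expr_mod _ zd).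
  by rewrite modnMmr.
split; first by rewrite /= /psi /chi /= !muln0 addn0 !expr0 !mulr1.
move=> [[[u v] x] y] [[[u' v'] x'] y'].
rewrite /= /psi /chi /= !exprD !red //=.
by rewrite [in RHS]mulrACA; congr (_ * _); exact: mulrACA.
Qed.

(* Main.v *)
(** The difference property is a finite count: the pairs with difference [g]
    correspond to the points of the intersection of [M1] with its translate by
    [g], which are enumerated for every [g]. For the character sum, put
    [w = zeta 3] and [z = zeta 8]; then [zeta 24 ^+ 22 = w ^+ 2 * z ^+ 2], so
    both sides are integer polynomials in [w] and [z], and they agree modulo
    [w ^+ 2 + w + 1 = 0] and [z ^+ 4 + 1 = 0]. *)

Require Import Defs.
From mathcomp Require Import all_boot all_order all_algebra.
From mathcomp Require Import reals trigo.
From mathcomp Require Import complex.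
From mathcomp Require Import ring lra.

Import Order.TTheory GRing.Theory Num.Theory.
Local Open Scope ring_scope.
Local Open Scope complex_scope.

Definition in_M (u v x y : nat) : bool :=
  nth false (nth [::] (M_rows u v) x) y.

Lemma in_M1 (u v : 'Z_3) (x : 'Z_8) (y : 'Z_2) :
  (((u, v, x, y) : grp) \in M1) = in_M u v x y.
Proof. by rewrite !inE. Qed.

Lemma big_grp (V : Type) (idx : V) (op : Monoid.com_law idx) (F : grp -> V) :
  \big[op/idx]_g F g = \big[op/idx]_(u < 3) \big[op/idx]_(v < 3)
    \big[op/idx]_(x < 8) \big[op/idx]_(y < 2) F (u, v, x, y).
Proof.
rewrite pair_bigA pair_bigA pair_bigA /=.
by apply: eq_bigr => -[[[u v] x] y].
Qed.

(** Nested list sums over natural numbers, a form in which [vm_compute] evaluates cardinalities in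
    [grp]. *)
Definition count_grp (F : nat -> nat -> nat -> nat -> bool) : nat :=
  sumn [seq sumn [seq sumn [seq sumn
    [seq nat_of_bool (F u v x y) | y <- iota 0 2]
    | x <- iota 0 8] | v <- iota 0 3] | u <- iota 0 3].

Lemma sum_ord_iota n (F : nat -> nat) :
  (\sum_(i < n) F i)%N = sumn [seq F i | i <- iota 0 n].
Proof.
by rewrite sumnE big_map -[n in iota 0 n]subn0 -/(index_iota 0 n) big_mkord.
Qed.

Lemma card_grp (A : {set grp}) (F : nat -> nat -> nat -> nat -> bool) :
  (forall (u v : 'Z_3) (x : 'Z_8) (y : 'Z_2),
     (((u, v, x, y) : grp) \in A) = F u v x y) ->
  #|A| = count_grp F.
Proof.
move=> AF; rewrite -sum1_card big_mkcond big_grp /count_grp -sum_ord_iota.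
apply: eq_bigr => u _; rewrite -sum_ord_iota; apply: eq_bigr => v _.
rewrite -sum_ord_iota; apply: eq_bigr => x _.
rewrite -sum_ord_iota; apply: eq_bigr => y _.
by rewrite AF; case: (F _ _ _ _).
Qed.

(** A pair with difference [g] is determined by its first entry [a], the second being [a - g]. *)
Lemma card_differences (G : finZmodType) (D : {set G}) (g : G) :
  #|[set ab in setX D D | ab.1 - ab.2 == g]| = #|[set a in D | a - g \in D]|.
Proof.
have inj : injective (fun a : G => (a, a - g)) by move=> a b [].
rewrite -(card_imset _ inj); apply: eq_card => -[a b]; rewrite !inE /=.
apply/idP/imsetP => [/andP[/andP[aD bD] /eqP <-]|[c]].
  by exists a; rewrite ?inE subKr ?aD.
by rewrite inE => /andP[cD cgD] [-> ->]; rewrite subKr cD cgD eqxx.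
Qed.

(* The translated coordinates follow the definitions of + and - on 'Z_n, so that
   membership of a difference in [M1] is [in_M] of them by conversion. *)
Definition shift_count (a b c d : nat) : nat :=
  count_grp (fun u v x y => in_M u v x y &&
    in_M ((u + (3 - a) %% 3) %% 3) ((v + (3 - b) %% 3) %% 3)
         ((x + (8 - c) %% 8) %% 8) ((y + (2 - d) %% 2) %% 2)).

(** The sum [a + b + c + d] is taken in [nat], so it vanishes only at the excluded translate by
    zero. *)
Lemma shift_count_M1 : all (fun a => all (fun b => all (fun c => all (fun d =>
    (a + b + c + d == 0)%N || (shift_count a b c d == 30)%N)
  (iota 0 2)) (iota 0 8)) (iota 0 3)) (iota 0 3).
Proof. by vm_compute. Qed.

Lemma difference_set_M1 : difference_set 144 66 30 M1.
Proof.
split.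
- by rewrite -cardsT (card_grp _ (fun _ _ _ _ => true)) // => *; rewrite inE.
- by rewrite (card_grp _ _ in_M1); vm_compute.
move=> [[[a b] c] d] g_neq0; rewrite card_differences.
transitivity (shift_count a b c d).
  by apply: card_grp => u v x y; rewrite inE in_M1 [X in X \in M1](_ : _ =
    (u - a, v - b, x - c, y - d)) // in_M1.
have mem n (i : 'I_n) : (i : nat) \in iota 0 n by rewrite mem_iota ltn_ord.
have /allP/(_ _ (mem 3 a))/allP/(_ _ (mem 3 b)) := shift_count_M1.
move=> /allP/(_ _ (mem 8 c))/allP/(_ _ (mem 2 d))/orP[|/eqP//].
rewrite !addn_eq0 => /andP[/andP[/andP[a0 b0] c0] d0]; case/eqP: g_neq0.
by do !congr pair; apply/val_inj/eqP.
Qed.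

Section Zeta.
Variable R : realType.

Lemma zeta_mul_exp (m k : nat) : (0 < m)%N -> (0 < k)%N ->
  zeta R (m * k) ^+ k = zeta R m.
Proof.
move=> m_gt0 k_gt0; rewrite zeta_expE /zeta -mulr_natr natrM.
by rewrite invfM mulrA mulfVK ?pnatr_eq0 -?lt0n.
Qed.

Lemma zeta2 : zeta R 2 = -1.
Proof.
rewrite /zeta mulrAC divff ?mul1r ?pnatr_eq0 // cospi sinpi.
by apply/eqP; rewrite eq_complex /= oppr0 !eqxx.
Qed.

Lemma zeta8_exp4 : zeta R 8 ^+ 4 = -1.
Proof. by rewrite (@zeta_mul_exp 2 4) // zeta2. Qed.

Lemma zeta3_neq1 : zeta R 3 != 1.
Proof.
(* The imaginary part is the sine of [2 * pi / 3], an angle strictly between 0 and [pi]. *)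
rewrite eq_complex /= negb_and; apply/orP; right.
by rewrite gt_eqF // sin_gt0_pi //; have := pi_gt0 R; lra.
Qed.

(** Cancel the nonzero factor [zeta R 3 - 1] from [zeta R 3 ^+ 3 - 1 = 0]. *)
Lemma zeta3_sqr : zeta R 3 ^+ 2 = - 1 - zeta R 3.
Proof.
have /eqP := @zeta_exp_order R 3 isT; rewrite -subr_eq0 => /eqP z3.
have : (zeta R 3 - 1) * (zeta R 3 ^+ 2 + zeta R 3 + 1) = 0 by rewrite -z3; ring.
move/eqP; rewrite mulf_eq0 subr_eq0 (negPf zeta3_neq1) /= => /eqP e.
by apply/eqP; rewrite -subr_eq0 -e; apply/eqP; ring.
Qed.

(** The exponent splits as 22 = 8 * 2 + 3 * 2. *)
Lemma zeta24_exp22 : zeta R 24 ^+ 22 = zeta R 3 ^+ 2 * zeta R 8 ^+ 2.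
Proof.
by rewrite -(@zeta_mul_exp 3 8) // -(@zeta_mul_exp 8 3) // -!exprM -exprD.
Qed.

Lemma conj_zeta (m : nat) : (zeta R m)^* * zeta R m = 1.
Proof.
apply/eqP; rewrite eq_complex /=; apply/andP; split; apply/eqP; last by ring.
by rewrite -[RHS](cos2Dsin2 (2 * pi / m%:R)); ring.
Qed.

(* The scope annotation selects Num.conj, as in the theorem: in complex_scope,
   ^* denotes conjc. *)
Lemma conj_zeta8 : ((zeta R 8)^*)%R = - zeta R 8 ^+ 3.
Proof.
(* Write 1 as [- zeta R 8 ^+ 4] and cancel one factor against the conjugate. *)
rewrite -[LHS]mulr1 -[1 in LHS]opprK -zeta8_exp4 exprS mulrN mulrA conj_zeta.
by rewrite mul1r.
Qed.

Lemma conj_gaussX : ((gaussX R)^*)%R = 1 - zeta R 8 - zeta R 8 ^+ 3.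
Proof.
rewrite /gaussX; move: (zeta R 8) zeta8_exp4 conj_zeta8 => z z4 conj_z.
rewrite !rmorphD rmorph1 rmorphXn /= conj_z.
(* The cubic term becomes [(- z ^+ 3) ^+ 3 = - z ^+ 9], which is [- z]. *)
by ring: z4.
Qed.

Lemma char_sum_M1 : char_sum (psichi R 0 1 1 0) M1 =
  2%:R * (zeta R 3 - zeta R 3 ^+ 2) * (gaussX R)^* * zeta R 24 ^+ 22.
Proof.
rewrite /char_sum big_mkcond big_grp.
(* The character ignores [u] and [y], so each [(v, x)] contributes one monomial, with multiplicity
   the number of points of [M1] above it. *)
transitivity (\sum_(v < 3) \sum_(x < 8) (zeta R 3 ^+ v * zeta R 8 ^+ x) *+
    sumn [seq sumn [seq nat_of_bool (in_M u v x y) | y <- iota 0 2]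
      | u <- iota 0 3]).
  rewrite exchange_big; apply: eq_bigr => v _.
  rewrite exchange_big; apply: eq_bigr => x _.
  rewrite -sum_ord_iota -sumrMnr; apply: eq_bigr => u _.
  rewrite -sum_ord_iota -sumrMnr; apply: eq_bigr => y _.
  rewrite in_M1 /= /psi /chi /= !mul0n !mul1n add0n expr0 mulr1.
  by case: (in_M _ _ _ _).
rewrite zeta24_exp22 conj_gaussX.
move: (zeta R 3) (zeta R 8) zeta3_sqr zeta8_exp4 => w z w2 z4.
rewrite !big_ord_recr !big_ord0 /=.
by ring: z4 w2.
Qed.

Lemma gauss_value_char_sum_M1 :
  gauss_value 6 (char_sum (psichi R 0 1 1 0) M1).
Proof.
split=> //; exists ((gaussX R)^*)%R, (zeta R 24 ^+ 22).
split; [by right| |].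
  exists 24; first by [].
  by apply/unity_rootP; rewrite exprAC (@zeta_exp_order R 24 isT) expr1n.
rewrite char_sum_M1 [in RHS](_ : 6%:R / 3%:R = 2%:R) //.
by rewrite -[6%N]/(2 * 3)%N natrM mulfK ?pnatr_eq0.
Qed.
End Zeta.

Theorem theorem4p1 (R : realType) :
  [/\ difference_set 144 66 30 M1,
      hadamard_difference_set 6 M1,
      is_character (psichi R 0 1 1 0),
      char_sum (psichi R 0 1 1 0) M1 =
        2%:R * (zeta R 3 - zeta R 3 ^+ 2) * (gaussX R)^* * zeta R 24 ^+ 22 &
      gauss_value 6 (char_sum (psichi R 0 1 1 0) M1)].
Proof.
have dM := difference_set_M1; split=> //.
- exact: psichi_is_character.
- exact: char_sum_M1.
- exact: gauss_value_char_sum_M1.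
Qed.
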